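(* Let $m\ge 0$ be an integer, let $0<q<1$ be real, let $n$ be an odd positive integer, and consider the pure quantum power time scale $q^{\mathbb{R}^n}$ with forward jump operator $\sigma(t)=qt^n$, and $\Lambda^2=q^{\mathbb{R}^n}\times q^{\mathbb{R}^n}$. Let $P(m,b,x)$ be the polynomial defined in the context. Then for every real $t$ with $\sigma(t)=qt^n>t$, $$D_{n,q}x^{2m+1}(t)=\frac{\partial P(m,b,x)}{\Delta x}(m,\sigma(t),t)+\frac{\partial P(m,b,x)}{\Delta b}(m,t,t),$$ where $D_{n,q}f(t)=\frac{f(qt^n)-f(t)}{qt^n-t}$ is the quantum power derivative.
   Context: The polynomial $P$. Define real coefficients $\mathbf{A}_{m,r}$, $0\le r\le m$, recursively (downward in $r$) by $\mathbf{A}_{m,m}=(2m+1)\binom{2m}{m}$ and, for $0\le r<m$, $\mathbf{A}_{m,r}=(2r+1)\binom{2r}{r}\sum_{d=2r+1}^{m}\mathbf{A}_{m,d}\binom{d}{2r+1}\frac{(-1)^{d-1}}{d-r}B_{2d-2r}$, where $B_k$ are the Bernoulli numbers (an empty sum is $0$). For nonnegative integers $b$, $P(m,b,x)=\sum_{k=0}^{b-1}\sum_{r=0}^{m}\mathbf{A}_{m,r}\,k^r(x-k)^r$ with the convention $0^0=1$. This is a polynomial in $x$ and $b$, and for arbitrary real $b,x$ the symbol $P(m,b,x)$ denotes the value of the unique polynomial in $b$ and $x$ that agrees with this sum for all nonnegative integers $b$ and all real $x$. Partial derivatives with respect to the jump $\sigma$ (arguments listed in the order $(m,b,x)$): $\frac{\partial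 P(m,b,x)}{\Delta x}(m,c,t)=\frac{P(m,c,\sigma(t))-P(m,c,t)}{\sigma(t)-t}$ and $\frac{\partial P(m,b,x)}{\Delta b}(m,t,c)=\frac{P(m,\sigma(t),c)-P(m,t,c)}{\sigma(t)-t}$. *)

(* Defs.v *)
From mathcomp Require Import all_boot all_order all_algebra.
From mathcomp Require Import all_classical all_reals.
From mathcomp Require Import ring.

Set Implicit Arguments.
Unset Strict Implicit.
Unset Printing Implicit Defensive.

Import Order.TTheory GRing.Theory Num.Theory.

Local Open Scope ring_scope.

(* [fuel] makes the recursion structural; any fuel >= n gives the value B_n of
   \sum_(k < n.+1) 'C(n.+1, k) * B_k = (n == 0), see [bernoulli_sum]. *)
Fixpoint bernoulli_rec (R : realType) (fuel n : nat) : R :=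
  (n == 0)%:R -
  if fuel is f.+1 then
    (\sum_(0 <= k < n) 'C(n.+1, k)%:R * bernoulli_rec R f k) / n.+1%:R
  else 0.

Definition bernoulli (R : realType) (n : nat) : R := bernoulli_rec R n n.

(* Downward recursion in r: the sum only involves indices d > r, so fuel
   m - r is enough; see [coefA_diag] and [coefA_lt]. *)
Fixpoint coefA_rec (R : realType) (m fuel r : nat) : R :=
  if r == m then (2 * m + 1)%:R * 'C(2 * m, m)%:R
  else if fuel is f.+1 then
    (2 * r + 1)%:R * 'C(2 * r, r)%:R *
    \sum_((2 * r + 1)%N <= d < m.+1)
      coefA_rec R m f d * 'C(d, 2 * r + 1)%:R
      * ((-1) ^+ (d - 1) / (d - r)%:R) * bernoulli R (2 * d - 2 * r)
  else 0.

Definition coefA (R : realType) (m r : nat) : R := coefA_rec R m (m - r) r.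

Definition powsum (R : realType) (m b : nat) (x : R) : R :=
  \sum_(0 <= k < b) \sum_(0 <= r < m.+1)
    coefA R m r * k%:R ^+ r * (x - k%:R) ^+ r.

(* In {poly {poly R}} the outer variable is b and the inner one is x, so that
   p.[b%:P].[x] is the value of p at (b, x). *)
Definition extends_powsum (R : realType) (m : nat) (p : {poly {poly R}}) : Prop :=
  forall (b : nat) (x : R), p.[b%:R%:P].[x] = powsum m b x.

(* The polynomial extending [powsum] exists and is unique:
   [extends_powsum_exists], [extends_powsum_unique]. *)
Definition polyP (R : realType) (m : nat) : {poly {poly R}} :=
  xget 0 [set p | extends_powsum m p]%classic.

Definition P (R : realType) (m : nat) (b x : R) : R := (polyP R m).[b%:P].[x].

(* Forward jump of q^{R^n} = {q s^n | s real}; for n odd and q <> 0 this set is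
   the whole real line, hence no membership condition on the arguments. *)
Definition sigma (R : realType) (n : nat) (q t : R) : R := q * t ^+ n.

Definition qpow_derive (R : realType) (n : nat) (q : R) (f : R -> R) (t : R) : R :=
  (f (q * t ^+ n) - f t) / (q * t ^+ n - t).

(* [F] is a function of (b, x); the last two arguments are the values of b and x,
   in this order, at which the derivative is taken. *)
Definition Delta_x (R : realType) (jump : R -> R) (F : R -> R -> R) (c t : R) : R :=
  (F c (jump t) - F c t) / (jump t - t).

Definition Delta_b (R : realType) (jump : R -> R) (F : R -> R -> R) (t c : R) : R :=
  (F (jump t) c - F t c) / (jump t - t).

Section Facts.
Variable R : realType.

Lemma bernoulli_rec_fuel (f g n : nat) :
  (n <= f)%N -> (n <= g)%N -> bernoulli_rec R f n = bernoulli_rec R g n.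
Proof.
elim: f g n => [|f IH] [|g] n //=; rewrite ?leqn0.
- by move=> /eqP-> _; rewrite big_geq // mul0r.
- by move=> _ /eqP->; rewrite big_geq // mul0r.
move=> nf ng; congr (_ - (_ : R) * _); apply: eq_big_nat => k /andP[_ kn].
by congr (_ * _); apply: IH; rewrite -ltnS; apply: leq_trans kn _.
Qed.

Lemma bernoulli_sum (n : nat) :
  \sum_(0 <= k < n.+1) 'C(n.+1, k)%:R * bernoulli R k = (n == 0)%:R.
Proof.
rewrite big_nat_recr //= binSn {2}/bernoulli.
case: n => [|n] /=; first by rewrite !big_geq // subr0 add0r mulr1.
rewrite sub0r mulrN mulrC divfK ?pnatr_eq0 //.
apply/eqP; rewrite subr_eq0; apply/eqP; apply: eq_big_nat => k /andP[_ kn].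
by congr (_ * _); apply: bernoulli_rec_fuel.
Qed.

Lemma coefA_rec_fuel (m f g r : nat) :
  (m - r <= f)%N -> (m - r <= g)%N -> coefA_rec R m f r = coefA_rec R m g r.
Proof.
have S0 h r' : (m - r' <= 0)%N -> r' != m -> \sum_((2 * r' + 1)%N <= d < m.+1)
   coefA_rec R m h d * 'C(d, 2 * r' + 1)%:R
   * ((-1) ^+ (d - 1) / (d - r')%:R) * bernoulli R (2 * d - 2 * r') = 0.
  rewrite leqn0 subn_eq0 => mr r'm; rewrite big_geq // addn1 ltnS mul2n -addnn.
  exact: leq_trans mr (leq_addr _ _).
elim: f g r => [|f IH] [|g] r //= rf rg; case: eqVneq => // rm.
- by rewrite S0 ?mulr0.
- by rewrite S0 ?mulr0.
congr (_ * _); apply: eq_big_nat => d /andP[rd dm]; congr (_ * _ * _ * _).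
have dr : (m - d < m - r)%N.
  have ltrd : (r < d)%N.
    by apply: leq_trans rd; rewrite addn1 ltnS mul2n -addnn leq_addr.
  by apply: ltn_sub2l => //; apply: leq_trans ltrd _.
by apply: IH; rewrite -ltnS; apply: leq_trans dr _.
Qed.

Lemma coefA_diag (m : nat) : coefA R m m = (2 * m + 1)%:R * 'C(2 * m, m)%:R.
Proof. by rewrite /coefA subnn /= eqxx. Qed.

Lemma coefA_lt (m r : nat) : (r < m)%N ->
  coefA R m r = (2 * r + 1)%:R * 'C(2 * r, r)%:R *
    \sum_((2 * r + 1)%N <= d < m.+1)
      coefA R m d * 'C(d, 2 * r + 1)%:R
      * ((-1) ^+ (d - 1) / (d - r)%:R) * bernoulli R (2 * d - 2 * r).
Proof.
move=> rm; rewrite {1}/coefA -(subnSK rm) /= (ltn_eqF rm).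
congr (_ * _); apply: eq_big_nat => d /andP[rd _]; congr (_ * _ * _ * _).
apply: coefA_rec_fuel => //; apply: leq_sub2l.
by apply: leq_trans rd; rewrite addn1 ltnS mul2n -addnn leq_addr.
Qed.

Lemma sum_exprn_poly (j : nat) :
  exists s : {poly R}, forall b : nat, s.[b%:R] = \sum_(0 <= k < b) k%:R ^+ j.
Proof.
elim/ltn_ind: j => j IH.
have [s sE] : exists s : nat -> {poly R}, forall i, (i < j)%N ->
    forall b : nat, (s i).[b%:R] = \sum_(0 <= k < b) k%:R ^+ i.
  have /choice[s sE] : forall i, exists s : {poly R}, (i < j)%N ->
      forall b : nat, s.[b%:R] = \sum_(0 <= k < b) k%:R ^+ i.
    by move=> i; case: (ltnP i j) => [/IH[s]|]; [exists s|exists 0].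
  by exists s.
exists (j.+1%:R^-1 *: ('X^(j.+1) - \sum_(i < j) 'C(j.+1, i)%:R *: s i)) => b.
apply: (@mulfI _ j.+1%:R); first by rewrite pnatr_eq0.
rewrite hornerZ mulVKf ?pnatr_eq0 //.
rewrite hornerD hornerN hornerXn horner_sum.
under eq_bigr => i _ do rewrite hornerZ (sE _ (ltn_ord i)).
elim: b => [|b IHb].
  rewrite big_geq // mulr0 expr0n /= sub0r big1 ?oppr0 // => i _.
  by rewrite big_geq // mulr0.
rewrite big_nat_recr //= mulrDr -{}IHb.
under eq_bigr => i _ do rewrite big_nat_recr //= mulrDr.
have -> : b.+1%:R ^+ j.+1 = b%:R ^+ j.+1 + j.+1%:R * b%:R ^+ j
    + \sum_(i < j) 'C(j.+1, i)%:R * b%:R ^+ i :> R.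
  rewrite -natr1 addrC exprDn !big_ord_recr /= subSnn subnn expr1n expr0 !mul1r.
  rewrite binn mulr1n -addrA addrC [X in X + _]addrC binSn -[_ *+ j.+1]mulr_natl.
  congr (_ + _); apply: eq_bigr => i _.
  by rewrite expr1n mul1r -mulr_natl.
by rewrite big_split /= opprD addrACA subrr addr0 addrAC.
Qed.

Lemma extends_powsum_exists (m : nat) :
  exists p : {poly {poly R}}, extends_powsum m p.
Proof.
have /choice[s sE] := sum_exprn_poly.
exists (\sum_(0 <= r < m.+1) \sum_(i < r.+1)
  map_poly polyC (s (r + i)%N) *
  ((coefA R m r * (-1) ^+ i * 'C(r, i)%:R) *: 'X^(r - i))%:P) => b x.
rewrite /powsum [RHS]exchange_big /= !horner_sum.
apply: eq_bigr => r _; rewrite !horner_sum.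
have E (i : 'I_r.+1) : (map_poly polyC (s (r + i)%N) *
  ((coefA R m r * (-1) ^+ i * 'C(r, i)%:R) *: 'X^(r - i))%:P).[b%:R%:P].[x] =
  \sum_(0 <= k < b)
    k%:R ^+ (r + i) * (coefA R m r * (-1) ^+ i * 'C(r, i)%:R * x ^+ (r - i)).
  rewrite hornerM horner_map /= hornerC hornerM hornerC hornerZ hornerXn sE.
  by rewrite mulr_suml.
transitivity (\sum_(i < r.+1) \sum_(0 <= k < b)
    k%:R ^+ (r + i) * (coefA R m r * (-1) ^+ i * 'C(r, i)%:R * x ^+ (r - i)) : R).
  by apply: eq_bigr => i _; exact: E.
rewrite exchange_big /=; apply: eq_bigr => k _.
rewrite exprBn mulr_sumr; apply: eq_bigr => i _.
rewrite exprD -(mulr_natl (_ * k%:R ^+ i)).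
by move: (x ^+ _) (k%:R ^+ r) (k%:R ^+ i) ((-1) ^+ i) => *; ring.
Qed.

Lemma poly_nat_eq (T : idomainType) (p q : {poly T}) :
  injective (fun n : nat => n%:R : T) ->
  (forall n : nat, p.[n%:R] = q.[n%:R]) -> p = q.
Proof.
move=> injn pq; apply/eqP; rewrite -subr_eq0; apply/negPn/negP => nz.
pose rs : seq T := [seq n%:R | n <- iota 0 (size (p - q))].
have rs_root : all (root (p - q)) rs.
  apply/allP => _ /mapP[n _ ->].
  by rewrite /root hornerD hornerN pq subrr.
have := max_poly_roots nz rs_root.
by rewrite size_map size_iota ltnn map_inj_uniq // iota_uniq => /(_ isT).
Qed.

Lemma extends_powsum_unique (m : nat) (p q : {poly {poly R}}) :
  extends_powsum m p -> extends_powsum m q -> p = q.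
Proof.
have injn : injective (fun n : nat => n%:R : R) by apply: mulrIn; rewrite oner_eq0.
move=> pE qE; apply: poly_nat_eq => [i j|b].
  by rewrite -!polyC_natr => /polyC_inj /injn.
by apply: poly_nat_eq => // n; rewrite -polyC_natr pE qE.
Qed.

Lemma polyP_spec (m : nat) : extends_powsum m (polyP R m).
Proof. by apply: xgetPex; exact: extends_powsum_exists. Qed.

Lemma P_nat (m b : nat) (x : R) : P m b%:R x = powsum m b x.
Proof. exact: polyP_spec. Qed.

End Facts.

(* Main.v *)
Require Import Defs.
From mathcomp Require Import all_boot all_order all_algebra.
From mathcomp Require Import all_classical all_reals.
From mathcomp Require Import ring zify.
Import Order.TTheory GRing.Theory Num.Theory.
Local Open Scope ring_scope.

(** On the right-hand side the two terms containing P(m, sigma t, t) cancel, so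
    the claim reduces to the diagonal identity P(m, b, b) = b^(2m+1) for all
    real b ([P_diag]). Both sides are polynomials in b, so it is enough to know
    it for natural b, where it reads
      sum_{k<b} sum_{r<=m} A_{m,r} k^r (b-k)^r = b^(2m+1)   ([powsum_diag]).

    The inner power sums have a closed form ([sum_symmonomial]): for
    f = X^r (b - X)^r, the Euler-Maclaurin formula, which is exact on
    polynomials ([euler_maclaurin]), gives
      sum_{k<b} f(k) = int_0^b f
                       + sum_{i>=0} B_{i+1}/(i+1)! (f^(i)(b) - f^(i)(0)).
    The integral is the Beta integral b^(2r+1) / ((2r+1) C(2r,r))
    ([beta_primitive]). The symmetry f(b - X) = f(X) makes
    f^(i)(b) = (-1)^i f^(i)(0), so only odd i contribute, with -2 f^(i)(0), and
    f^(i)(0)/i! is a coefficient of f: a signed binomial times a power of b.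
    The odd i whose coefficient can be nonzero are i = 2(r-s)-1 with 2s+1 <= r,
    and they produce the monomials b^(2s+1).

    Summing over r with weights A_{m,r}, the coefficient of b^(2s+1) is
    A_{m,s} / ((2s+1) C(2s,s)) minus exactly the sum over d >= 2s+1 in the
    recursion defining A_{m,s}. It therefore vanishes for s < m and is 1 for
    s = m. *)

(** * Derivatives and Taylor expansion *)

Lemma natr_fact_neq0 (F : numFieldType) (n : nat) : n`!%:R != 0 :> F.
Proof. by rewrite pnatr_eq0 -lt0n fact_gt0. Qed.

Lemma size_derivn_leq {F : numFieldType} (p : {poly F}) (n j : nat) :
  (size p <= n)%N -> (size p^`(j) <= n - j)%N.
Proof.
move=> pn; elim: j => [|j IH]; first by rewrite subn0.
rewrite derivnS; have [->|nz] := eqVneq p^`(j) 0; first by rewrite deriv0 size_poly0.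
have := lt_size_deriv nz; lia.
Qed.

Lemma derivnD (F : numFieldType) (p : {poly F}) (i j : nat) :
  p^`(j)^`(i) = p^`(i + j).
Proof. by rewrite /derivn iterD. Qed.

Lemma derivn_taylor1 {F : numFieldType} (p : {poly F}) (n : nat) (x : F) :
  (size p <= n)%N -> p.[x + 1] = \sum_(0 <= i < n) p^`(i).[x] / i`!%:R.
Proof.
move=> pn; rewrite (nderiv_taylor_wide (mulrC _ _) pn) big_mkord.
apply: eq_bigr => i _.
by rewrite expr1n mulr1 nderivn_def hornerMn -[_ *+ _]mulr_natr mulfK ?natr_fact_neq0.
Qed.

(** * The Euler-Maclaurin formula for polynomials *)

(** The umbral relation (B + 1)^k = B^k + [k = 1], the form in which the
    Bernoulli recursion enters the Euler-Maclaurin formula. *)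
Lemma bernoulli_binomial_sum (R : realType) (k : nat) :
  \sum_(0 <= j < k.+1) 'C(k, j)%:R * bernoulli R j = bernoulli R k + (k == 1)%:R.
Proof.
rewrite big_nat_recr //= binn mul1r addrC; congr (_ + _).
by case: k => [|k]; [rewrite big_geq|rewrite bernoulli_sum].
Qed.

(** The truncation of the operator D / (exp D - 1), D being differentiation:
    for i < n it sends X^i to the i-th Bernoulli polynomial. *)
Definition euler_maclaurin_op {R : realType} (n : nat) (p : {poly R}) (x : R) : R :=
  \sum_(0 <= j < n) bernoulli R j / j`!%:R * p^`(j).[x].

(** The unit shift is exp D, so the difference of [euler_maclaurin_op] at x + 1
    and x is D p. Concretely, Taylor expansion of each derivative of p turns the
    left-hand side into the sum over k of p^(k)(x) / k! times
    sum_{j<=k} C(k,j) B_j, and the umbral relation leaves one extra term, at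
    k = 1. *)
Lemma euler_maclaurin_opS (R : realType) (n : nat) (p : {poly R}) (x : R) :
  (size p <= n)%N -> euler_maclaurin_op n p (x + 1) =
  euler_maclaurin_op n p x + p^`().[x].
Proof.
move=> pn; rewrite /euler_maclaurin_op.
transitivity (\sum_(0 <= j < n) \sum_(0 <= k < n | (j <= k)%N)
   'C(k, j)%:R * bernoulli R j * (p^`(k).[x] / k`!%:R)).
  apply: eq_big_nat => j /andP[_ jn].
  rewrite (derivn_taylor1 _ _ _ (size_derivn_leq _ _ _ pn)).
  rewrite -(big_nat_widenl j 0 n xpredT) // [RHS](big_addn 0 n j) mulr_sumr.
  apply: eq_bigr => i _; rewrite derivnD.
  have /(congr1 (fun z => z%:R : R)) := bin_fact (leq_addl i j).
  rewrite addnK !natrM => <-.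
  have bnz : 'C(i + j, j)%:R != 0 :> R by rewrite pnatr_eq0 -lt0n bin_gt0 leq_addl.
  have := natr_fact_neq0 R i; have := natr_fact_neq0 R j => jnz inz.
  by field; rewrite bnz jnz inz.
rewrite (exchange_big_dep_nat xpredT) //=.
transitivity (\sum_(0 <= k < n) (bernoulli R k + (k == 1)%:R) * (p^`(k).[x] / k`!%:R)).
  apply: eq_big_nat => k /andP[_ kn].
  rewrite -bernoulli_binomial_sum mulr_suml [RHS](big_nat_widen _ _ n) //.
under [LHS]eq_bigr => k _ do rewrite mulrDl.
rewrite big_split /=; congr (_ + _); first by apply: eq_bigr => k _; ring.
(* The extra summand is the one at k = 1; for n < 2 it is absent from the sum,
   but then p is constant. *)
case: n pn => [|[|n]] pn.
- by move: pn; rewrite leqn0 size_poly_eq0 => /eqP->; rewrite big_geq // deriv0 horner0.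
- by rewrite big_nat1 /= mul0r (size1_polyC pn) derivC horner0.
rewrite big_nat_recl // big_nat_recl // big1 ?mul0r ?mul1r ?divr1 ?addr0 ?add0r //.
by move=> i _; rewrite mul0r.
Qed.

(** By [euler_maclaurin_opS] the sum telescopes. The integrand is p', so the
    term j = 0 is its integral from 0 to b. *)
Lemma euler_maclaurin (R : realType) (n b : nat) (p : {poly R}) :
  (size p <= n)%N -> \sum_(0 <= k < b) p^`().[k%:R] =
  \sum_(0 <= j < n) bernoulli R j / j`!%:R * (p^`(j).[b%:R] - p^`(j).[0]).
Proof.
move=> pn; transitivity (euler_maclaurin_op n p b%:R - euler_maclaurin_op n p 0%:R).
  rewrite -(telescope_sumr (fun k : nat => euler_maclaurin_op n p k%:R) (leq0n b)) //.
  by apply: eq_bigr => k _; rewrite -natr1 euler_maclaurin_opS // addrC addKr.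
by rewrite -sumrB; apply: eq_bigr => j _; rewrite mulrBr.
Qed.

(** * Primitives and the Beta integral *)

Definition primitive {F : numFieldType} (p : {poly F}) : {poly F} :=
  \poly_(i < (size p).+1) (p`_i.-1 / i%:R).

Lemma coef_primitive {F : numFieldType} (p : {poly F}) (i : nat) :
  (primitive p)`_i = p`_i.-1 / i%:R.
Proof.
rewrite coef_poly; case: i => [|i] /=; first by rewrite invr0 mulr0.
rewrite ltnS; case: ltnP => // pi.
by rewrite nth_default // mul0r.
Qed.

Lemma deriv_primitive {F : numFieldType} (p : {poly F}) : (primitive p)^`() = p.
Proof.
apply/polyP => i; rewrite coef_deriv coef_primitive /= -[_ *+ _]mulr_natr divfK //.
by rewrite pnatr_eq0.
Qed.

Lemma deriv_eq0_horner {F : numFieldType} (p : {poly F}) (x y : F) :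
  p^`() = 0 -> p.[x] = p.[y].
Proof.
move=> p0; suff /size1_polyC-> : (size p <= 1)%N by rewrite !hornerC.
apply/leq_sizeP => -[//|j] _; have /polyP/(_ j) := p0.
by rewrite coef_deriv coef0 => /eqP; rewrite mulrn_eq0 => /eqP.
Qed.

(** The Beta integral of x^a (c - x)^b over [0, c], by integration by parts:
    the derivative of X^(a+1) (c - X)^(b+1) relates the exponents (a, b+1) to
    (a+1, b), and the boundary terms vanish. *)
Lemma beta_primitive {F : numFieldType} (a b : nat) (c : F) (p : {poly F}) :
  p^`() = 'X^a * (c%:P - 'X) ^+ b ->
  p.[c] - p.[0] = c ^+ (a + b).+1 * (a`! * b`!)%:R / (a + b).+1`!%:R.
Proof.
elim: b a p => [|b IH] a p dp.
  have : (a.+1%:R *: p - 'X^(a.+1))^`() = 0.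
    by rewrite !derivE dp expr0 mulr1 /= scaler_nat subrr.
  move/(deriv_eq0_horner _ c 0); rewrite !hornerE expr0n /= subr0 => E.
  have nz : a.+1%:R != 0 :> F by rewrite pnatr_eq0.
  apply: (mulfI nz); rewrite mulrBr -E factS natrM.
  by have az := natr_fact_neq0 F a; field; rewrite az addrC natr1 nz.
pose g := primitive ('X^(a.+1) * (c%:P - 'X) ^+ b).
have dg : g^`() = 'X^(a.+1) * (c%:P - 'X) ^+ b by exact: deriv_primitive.
have : (a.+1%:R *: p - b.+1%:R *: g - 'X^(a.+1) * (c%:P - 'X) ^+ b.+1)^`() = 0.
  rewrite !derivE dp dg deriv_exp !derivE /= !scaler_nat sub0r exprS.
  by move: ('X^a) ('X^(a.+1)) (_ ^+ b) => u v w; ring.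
move/(deriv_eq0_horner _ c 0).
rewrite !(hornerE, horner_exp) subrr !expr0n /= !(mulr0, mul0r, subr0).
have := IH _ _ dg; rewrite addSn => /(canRL (subrK _)) -> E.
have nz : a.+1%:R != 0 :> F by rewrite pnatr_eq0.
have {}E : a.+1%:R * p.[c] = a.+1%:R * p.[0] - b.+1%:R * g.[0] +
    b.+1%:R * (c ^+ (a + b).+2 * (a.+1`! * b`!)%:R / (a + b).+2`!%:R + g.[0]).
  by apply/eqP; rewrite -subr_eq E.
by apply: (mulfI nz); rewrite mulrBr E addnS !factS !natrM; ring.
Qed.

(** * Power sums of X^r (c - X)^r *)

Lemma derivn_comp_reflect {F : numFieldType} (c : F) (p : {poly F}) (j : nat) :
  (p \Po (c%:P - 'X))^`(j) = (-1) ^+ j *: (p^`(j) \Po (c%:P - 'X)).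
Proof.
elim: j => [|j IH]; first by rewrite expr0 scale1r.
rewrite derivnS IH derivZ deriv_comp -derivnS !derivE sub0r exprS.
by rewrite mulrN1 scalerN mulN1r scaleNr.
Qed.

Definition symmonomial {F : numFieldType} (r : nat) (c : F) : {poly F} :=
  'X^r * (c%:P - 'X) ^+ r.

(** The polynomial is invariant under X |-> c - X, which exchanges 0 and c. *)
Lemma derivn_symmonomial_reflect {F : numFieldType} (r : nat) (c : F) (j : nat) :
  (symmonomial r c)^`(j).[c] = (-1) ^+ j * (symmonomial r c)^`(j).[0].
Proof.
have sym : symmonomial r c \Po (c%:P - 'X) = symmonomial r c.
  rewrite /symmonomial rmorphM !rmorphXn rmorphB /= comp_polyX comp_polyC.
  by rewrite subKr mulrC.
rewrite -{1}sym derivn_comp_reflect hornerZ horner_comp.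
by rewrite !hornerE subrr.
Qed.

Lemma coef_symmonomial {F : numFieldType} (r : nat) (c : F) (i : nat) :
  (symmonomial r c)`_(r + i) = (-1) ^+ i * c ^+ (r - i) * 'C(r, i)%:R.
Proof.
rewrite coefXnM ltnNge leq_addr /= addKn exprBn coef_sum.
have E (k : nat) : ((-1) ^+ k * c%:P ^+ (r - k) * 'X^k *+ 'C(r, k))`_i =
    if k == i then (-1) ^+ k * c ^+ (r - k) * 'C(r, k)%:R else 0.
  rewrite coefMn -rmorphXn /= -(rmorphN1 polyC) -rmorphXn -polyCM coefCM coefXn.
  by rewrite eq_sym; case: eqP => _; rewrite ?mulr1 ?mulr0 ?mul0rn // mulr_natr.
under eq_bigr => k _ do rewrite E.
rewrite -big_mkcond /=; have [ir|ri] := ltnP i r.+1.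
  by rewrite (big_pred1 (Ordinal ir)) // => k.
rewrite bin_small // mulr0 big1 // => k /eqP ki; move: (ltn_ord k); lia.
Qed.

Lemma big_nat_double (V : nmodType) (n : nat) (f : nat -> V) :
  \sum_(0 <= j < 2 * n) f j = \sum_(0 <= u < n) (f (2 * u)%N + f (2 * u).+1).
Proof.
elim: n => [|n IH]; first by rewrite !big_geq.
by rewrite mulnS !addSn add0n !big_nat_recr //= IH addrA.
Qed.

(** Euler-Maclaurin applied to X^r (b - X)^r. The s-th term comes from the
    derivative of order i = 2(r-s)-1. When r <= 2s the binomial vanishes, hence
    the freedom in the upper bound m, which allows the same range of s for all
    r <= m in [powsum_diag]. *)
Lemma sum_symmonomial (R : realType) (m r b : nat) : (r <= m)%N ->
  \sum_(0 <= k < b) k%:R ^+ r * (b%:R - k%:R) ^+ r =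
  b%:R ^+ (2 * r + 1) / ((2 * r + 1)%:R * 'C(2 * r, r)%:R)
  - \sum_(0 <= s < m.+1) 'C(r, 2 * s + 1)%:R * ((-1) ^+ (r - 1) / (r - s)%:R)
      * bernoulli R (2 * r - 2 * s) * b%:R ^+ (2 * s + 1) :> R.
Proof.
move=> rm; pose f := symmonomial r (b%:R : R); pose p := primitive f.
have dp : p^`() = f by exact: deriv_primitive.
have sp : (size p <= 2 * r.+1)%N.
  apply: leq_trans (size_poly _ _) _; rewrite mulnS ltnS.
  apply: leq_trans (size_polyMleq _ _) _; rewrite size_polyXn addSn /=.
  have := size_poly_exp_leq (b%:R%:P - 'X : {poly R}) r.
  rewrite -opprB size_polyN size_XsubC mul1n; move: (size _) => d; lia.
have -> : \sum_(0 <= k < b) k%:R ^+ r * (b%:R - k%:R) ^+ r =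
    \sum_(0 <= k < b) p^`().[k%:R] :> R.
  by apply: eq_bigr => k _; rewrite dp !(hornerE, horner_exp).
(* D j is the j-th Euler-Maclaurin term; DS uses the reflection symmetry. *)
pose D j := bernoulli R j / j`!%:R * (p^`(j).[b%:R] - p^`(j).[0]).
have DS i : D i.+1 = bernoulli R i.+1 / i.+1%:R * ((-1) ^+ i - 1) * f`_i.
  rewrite /D derivSn dp derivn_symmonomial_reflect horner_coef0 coef_derivn.
  rewrite addn0 ffactnn -/f factS natrM -[_ *+ _]mulr_natr.
  have := natr_fact_neq0 R i => inz.
  by field; rewrite inz addrC natr1 pnatr_eq0.
have D0 : D 0 = b%:R ^+ (2 * r + 1) / ((2 * r + 1)%:R * 'C(2 * r, r)%:R).
  rewrite /D /bernoulli /= subr0 (beta_primitive _ _ _ _ dp) addn1 mul2n -addnn.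
  rewrite fact0 factS -(bin_fact (leq_addr r r)) addKn !natrM.
  have bnz : 'C(r + r, r)%:R != 0 :> R by rewrite pnatr_eq0 -lt0n bin_gt0 leq_addr.
  have := natr_fact_neq0 R r => inz.
  have nz : (r + r).+1%:R != 0 :> R by rewrite pnatr_eq0.
  move: nz bnz inz (b%:R ^+ _); move: _.+1%:R 'C(_, _)%:R r`!%:R => u v w unz vnz wnz z.
  by field; rewrite unz vnz wnz.
have Dodd u : D (2 * u).+1 = 0.
  by rewrite DS exprM sqrrN expr1n expr1n subrr mulr0 mul0r.
rewrite (euler_maclaurin _ _ _ _ sp) -/(\sum_(0 <= j < _) D j) big_nat_double.
rewrite big_nat_recl // Dodd addr0 D0; congr (_ + _).
(* Cut the sum over s at r, beyond which 2s+1 > r, and reverse it so that s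
   matches the term of index j = 2(r-s). *)
rewrite [X in - X](@big_cat_nat _ _ _ r) //=; last exact: leqW.
rewrite [X in - (_ + X)]big_nat_cond [X in - (_ + X)]big1; last first.
  by move=> s /andP[/andP[rs _] _]; rewrite bin_small ?mul0r //; lia.
rewrite addr0 big_nat_rev /= -sumrN; apply: eq_big_nat => s /andP[_ sr].
have -> : (0 + r - s.+1).+1 = (r - s)%N by lia.
rewrite Dodd addr0 -mulnBr.
have -> : (2 * (r - s))%N = (2 * (r - s)).-1.+1 by lia.
rewrite DS /f; set i := (2 * (r - s)).-1.
have -> : (-1) ^+ i = -1 :> R by rewrite -signr_odd (_ : odd i = true) // /i; lia.
have -> : i.+1%:R = 2 * (r - s)%:R :> R by rewrite -natrM; congr (_%:R); lia.
have rsnz : (r - s)%:R != 0 :> R by rewrite pnatr_eq0; lia.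
have [rs|rs] := leqP (2 * s + 1) r; last first.
  by rewrite bin_small // coefXnM ifT ?mulr0 ?mul0r ?oppr0 // /i; lia.
have -> : i = (r + (r - (2 * s + 1)))%N by rewrite /i; lia.
rewrite coef_symmonomial subKn // bin_sub //.
have -> : (-1) ^+ (r - (2 * s + 1)) = (-1) ^+ (r - 1) :> R.
  by rewrite -signr_odd -[RHS]signr_odd; congr (_ ^+ nat_of_bool _); lia.
by field; rewrite rsnz.
Qed.

(** * The diagonal of P *)

(** The recursion for A_{m,s} says precisely that, after exchanging the two
    sums, the coefficient of b^(2s+1) is zero for every s < m; the diagonal
    value A_{m,m} makes the coefficient of b^(2m+1) equal to 1. *)
Lemma powsum_diag (R : realType) (m b : nat) :
  powsum m b b%:R = b%:R ^+ (2 * m + 1) :> R.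
Proof.
rewrite /powsum exchange_big_nat /=.
(* T r s is the s-th term of the closed form of the r-th power sum, and c r the
   inverse of its Beta constant. *)
pose T r s : R := 'C(r, 2 * s + 1)%:R * ((-1) ^+ (r - 1) / (r - s)%:R)
      * bernoulli R (2 * r - 2 * s) * b%:R ^+ (2 * s + 1).
pose c r : R := (2 * r + 1)%:R * 'C(2 * r, r)%:R.
have cnz r : c r != 0.
  by rewrite /c -natrM pnatr_eq0 muln_eq0 addn1 /= -lt0n bin_gt0; lia.
transitivity (\sum_(0 <= r < m.+1) (coefA R m r / c r * b%:R ^+ (2 * r + 1)
    - \sum_(0 <= s < m.+1) coefA R m r * T r s)).
  apply: eq_big_nat => r /andP[_ rm].
  under [LHS]eq_bigr => k _ do rewrite -mulrA.
  rewrite -[LHS]mulr_sumr (sum_symmonomial _ m) // mulrBr mulr_sumr -/(c r).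
  by congr (_ - _); rewrite mulrA mulrAC.
rewrite sumrB [X in _ - X]exchange_big_nat /= -sumrB big_nat_recr //=.
rewrite [X in X + _]big_nat_cond [X in X + _]big1 ?add0r => [|s].
  rewrite coefA_diag -/(c m) divff // mul1r [X in _ - X]big_nat_cond.
  rewrite big1 ?subr0 // => r /andP[/andP[_ rm] _].
  by rewrite /T bin_small ?mul0r ?mulr0 //; lia.
move=> /andP[/andP[_ sm] _]; apply/eqP; rewrite subr_eq0; apply/eqP.
rewrite (coefA_lt _ sm) -/(c s) [c s * _]mulrC mulfK // mulr_suml.
rewrite (big_nat_widenl _ 0) // big_mkcond; apply: eq_bigr => d _ /=.
case: leqP => sd; last by rewrite /T bin_small ?mul0r ?mulr0 //; lia.
by rewrite /T !mulrA.
Qed.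

(** Substituting x = b means evaluating the outer variable at 'X; the resulting
    univariate polynomial agrees with X^(2m+1) on the natural numbers. *)
Lemma P_diag (R : realType) (m : nat) (b : R) : P m b b = b ^+ (2 * m + 1).
Proof.
have horner_diag x : (Defs.polyP R m).['X].[x] = P m x x.
  rewrite /P !(horner_coef (Defs.polyP R m)) !horner_sum; apply: eq_bigr => i _.
  by rewrite !hornerE.
rewrite -horner_diag.
suff -> : (Defs.polyP R m).['X] = 'X^(2 * m + 1) by rewrite hornerXn.
apply: poly_nat_eq => [|k]; first by apply: mulrIn; rewrite oner_eq0.
by rewrite horner_diag P_nat powsum_diag hornerXn.
Qed.

Theorem corollary4p17 (R : realType) (m n : nat) (q t : R)
    (q_gt0 : 0 < q) (q_lt1 : q < 1) (n_odd : odd n)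
    (t_lt_sigma : t < sigma n q t) :
  qpow_derive n q (fun x : R => x ^+ (2 * m + 1)) t =
    Delta_x (sigma n q) (P m) (sigma n q t) t
    + Delta_b (sigma n q) (P m) t t.
Proof.
rewrite /qpow_derive /Delta_x /Delta_b -mulrDl addrA subrK.
by rewrite !P_diag.
Qed.
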